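(* Let $M$ be a manifold, let $X$ be a diffeological space, and let $\phi:M\rightarrow\mathfrak{P}^\star(X)$ be a set-valued map. Then $\phi$ is smooth with respect to the union power set diffeology if and only if for each $p_0\in M$ and $x_0\in\phi(p_0)$ there exist a D-open neighborhood $O\subset M$ of $p_0$ and a smooth map $\alpha:O\rightarrow X$ such that $\alpha(p_0)=x_0$ and $\alpha(p)\in\phi(p)$ for all $p\in O$.
   Context: A parametrization in a set $X$ is a map $P:U\to X$ with $U$ an open subset of some $\mathbb{R}^n$. A diffeology on $X$ is a set of parametrizations in $X$ (called plots) that contains all constant parametrizations, is local, and is stable under precomposition with smooth maps between open subsets of Euclidean spaces. A map $f$ between diffeological spaces is smooth if $f\circ P$ is a plot for every plot $P$. A subset is D-open if its preimage under every plot is open. Subsets carry the subset diffeology (plots with image in the subset). $M$ is a finite-dimensional smooth manifold with its standard diffeology (plots are the usual smooth maps from open subsets of Euclidean spaces to $M$); its D-topology is the manifold topology. $\mathfrak{P}^\star(X)$ is the set of nonempty subsets of $X$. Union power set diffeology on the set $\mathfrak{P}(X)$ of all subsets: $P:U\to\mathfrak{P}(X)$ is a plot iff there is a family of parametrizations $P_i:U_i\to\mathfrak{P}(X)$ ($i\in J$, $U_i$ open in the same Euclidean space, $U=\bigcup_i U_i$), each either constant with value $\emptyset$ or of the form $r\mapsto\{p_i(r)\}$ for a plot $p_i:U_i\to X$, such that $P(r)=\bigcup\{P_i(r)\mid i\in J,\ r\in U_i\}$ for all $r\in U$. Equivalently: for every $r_0\in U$ and $x_0\in P(r_0)$ there exist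 an open neighborhood $V\subset U$ of $r_0$ and a plot $\sigma:V\to X$ with $\sigma(r)\in P(r)$ for all $r\in V$ and $\sigma(r_0)=x_0$. $\mathfrak{P}^\star(X)$ carries the corresponding subset diffeology. *)

(* Defs.v *)
From HB Require Import structures.
From mathcomp Require Import all_boot all_order all_algebra.
From mathcomp Require Import all_classical all_reals all_analysis.
Set Implicit Arguments. Unset Strict Implicit. Unset Printing Implicit Defensive.
Import Order.TTheory GRing.Theory Num.Theory.
Import numFieldNormedType.Exports.
Local Open Scope classical_set_scope.
Local Open Scope ring_scope.

(* A parametrization with domain [U : set 'rV[R]_n] is a function on the sigma
   type [U] (coercion [set_type]), not a total function with junk values. *)

(* [Ck k U f]: [f] is of class C^k on the open set [U]: continuous for [k = 0],
   and for [k.+1] Frechet differentiable on [U] with every map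
   x |-> 'd f x v of class C^k.  On an open [U] only the values of [f] on [U]
   matter (lemma [Ck_ext]). *)
Fixpoint Ck {R : realType} {V W : normedModType R} (k : nat) (U : set V)
    (f : V -> W) : Prop :=
  if k is k'.+1 then
    (forall x, U x -> differentiable f x) /\ (forall v, Ck k' U ('D_v f))
  else forall x, U x -> {for x, continuous f}.

Section Ck_theory.
Context {R : realType}.

Lemma near_eq_differentiable (V W : normedModType R) (f g : V -> W) (x : V) :
  (\forall y \near x, f y = g y) -> differentiable f x -> differentiable g x.
Proof.
move=> fg df.
have -> : g = f + (g - f) by rewrite addrC subrK.
apply: differentiableD => //; set h := g - f.
have h0 : \forall y \near x, h y = 0.
  by move: fg; apply: filterS => y e; rewrite /h !fctE e subrr.
have hx : h x = 0 by exact: nbhs_singleton h0.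
have c0 : continuous (\0 : {linear V -> W}) by move=> y; exact: cvg_cst.
have H : h \o shift x = cst (h x) + (\0 : {linear V -> W}) +o_ 0 id.
  rewrite hx; apply/eqaddoP => e e0.
  near=> y; rewrite !fctE /= (_ : h (y + x) = 0).
    by rewrite addr0 subr0 normr0 mulr_ge0 // ltW.
  near: y; have := h0; rewrite (near_shift 0) /= => hh.
  by move: hh; apply: filterS => y; rewrite /= subr0.
apply/diff_locallyP; rewrite (diff_unique c0 H); split => //.
Unshelve. all: by end_near. Qed.

Lemma Ck_ext (V W : normedModType R) k (U : set V) (f g : V -> W) :
  open U -> (forall x, U x -> f x = g x) -> Ck k U f -> Ck k U g.
Proof.
move=> oU; elim: k f g => [|k IH] f g fg.
  move=> cf x Ux; change (g @ x --> g x); rewrite -(fg x Ux).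
  apply: cvg_trans (cf x Ux); apply: near_eq_cvg.
  by near=> y; apply: fg; near: y; exact: open_nbhs_nbhs.
move=> [df cf]; split=> [x Ux|v].
  apply: near_eq_differentiable (df x Ux).
  by near=> y; apply: fg; near: y; exact: open_nbhs_nbhs.
apply: (IH ('D_v f)) (cf v) => x Ux; apply: near_eq_derive.
by near=> y; apply: fg; near: y; exact: open_nbhs_nbhs.
Unshelve. all: by end_near. Qed.

Lemma CkW (V W : normedModType R) k (U : set V) (f : V -> W) :
  Ck k.+1 U f -> Ck k U f.
Proof.
elim: k f => [|k IH] f [df cf]; first by move=> x Ux; exact/differentiable_continuous/df.
by split => // v; exact: IH.
Qed.

Lemma Ck0 (V W : normedModType R) k (U : set V) (f : V -> W) :
  Ck k U f -> Ck 0 U f.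
Proof. by elim: k => [|k IH] // /CkW. Qed.

Lemma Ck_subset (V W : normedModType R) k (U U' : set V) (f : V -> W) :
  U' `<=` U -> Ck k U f -> Ck k U' f.
Proof.
move=> s; elim: k f => [|k IH] f /=; first by move=> c x /s; exact: c.
by case=> df cf; split=> [x /s|v]; [exact: df|exact: IH].
Qed.

Lemma Ck_local (V W : normedModType R) k (U : set V) (f : V -> W) :
  (forall x, U x -> exists2 U' : set V, U' x & Ck k U' f) -> Ck k U f.
Proof.
elim: k f => [|k IH] f H /=; first by move=> x /H[U' U'x]; exact.
split=> [x /H[U' U'x [df _]]|v]; first exact: df.
by apply: IH => x /H[U' U'x [_ cf]]; exists U'; last exact: cf.
Qed.

Lemma Ck_cst (V W : normedModType R) k (U : set V) (a : W) : Ck k U (cst a).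
Proof.
elim: k a => [|k IH] a /=; first by move=> x _; exact: cvg_cst.
split=> [x _|v]; first exact: differentiable_cst.
suff -> : 'D_v (cst a) = cst (0 : W) :> (V -> W) by [].
by apply/funext => x; rewrite derive_cst.
Qed.

Lemma CkD (V W : normedModType R) k (U : set V) (f g : V -> W) :
  open U -> Ck k U f -> Ck k U g -> Ck k U (f + g).
Proof.
move=> oU; elim: k f g => [|k IH] f g /=.
  by move=> cf cg x Ux; apply: (@cvgD _ _ _ _ _ f g); [exact: cf|exact: cg].
move=> [df cf] [dg cg]; split=> [x Ux|v].
  by apply: differentiableD; [exact: df|exact: dg].
apply: (@Ck_ext _ _ _ _ ('D_v f + 'D_v g)) => // [x Ux|].
  by rewrite deriveD //; apply: diff_derivable; [exact: df|exact: dg].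
exact: IH.
Qed.

Lemma Ck_sum (V W : normedModType R) k (U : set V) n (f : 'I_n -> V -> W) :
  open U -> (forall i, Ck k U (f i)) -> Ck k U (\sum_(i < n) f i).
Proof.
move=> oU cf; apply: (big_ind (fun g => Ck k U g)) => //.
  exact: (Ck_cst k U (0 : W)).
by move=> g h; exact: CkD.
Qed.

Lemma CkM (V : normedModType R) k (U : set V) (f g : V -> R) :
  open U -> Ck k U f -> Ck k U g -> Ck k U (f * g).
Proof.
move=> oU; elim: k f g => [|k IH] f g.
  by move=> cf cg x Ux; apply: (@cvgM _ _ _ _ f g); [exact: cf|exact: cg].
move=> Hf Hg; have := Hf; have := Hg; move=> [dg cg] [df cf]; split=> [x Ux|v].
  by apply: differentiableM; [exact: df|exact: dg].
apply: (@Ck_ext _ _ _ _ (f * 'D_v g + g * 'D_v f)) => // [x Ux|].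
  by rewrite deriveM //; apply: diff_derivable; [exact: df|exact: dg].
by apply: CkD => //; apply: IH => //; first [exact: CkW|exact: cg|exact: cf].
Qed.

Lemma Ck_coord (V : normedModType R) m k (U : set V) (f : V -> 'rV[R]_m) (j : 'I_m) :
  open U -> Ck k U f -> Ck k U (fun x => f x ord0 j).
Proof.
move=> oU; elim: k f => [|k IH] f.
  move=> cf x Ux; apply: (@continuous_comp _ _ _ f (fun M : 'rV[R]_m => M ord0 j)).
    exact: cf.
  exact: coord_continuous.
move=> [df cf]; split=> [x Ux|v].
  apply: (@differentiable_comp _ _ _ _ f (fun M : 'rV[R]_m => M ord0 j)).
    exact: df.
  exact: differentiable_coord.
apply: (@Ck_ext _ _ _ _ (fun x => 'D_v f x ord0 j)) => //; last by apply: IH; exact: cf.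
move=> x Ux; have Hd : derivable f x v by apply: diff_derivable; exact: df.
by rewrite (derive_mx Hd) mxE.
Qed.

Lemma Ck_rV (V : normedModType R) m k (U : set V) (f : V -> 'rV[R]_m) :
  open U -> (forall j, Ck k U (fun x => f x ord0 j)) -> Ck k U f.
Proof.
move=> oU cf.
have key (a : V -> R) (w : 'rV[R]_m) : Ck k U a -> Ck k U (fun x => a x *: w).
  elim: k a {cf} => [|l IH] a.
    by move=> ca x Ux; apply: cvgZr_tmp; exact: ca.
  move=> [da ca]; split=> [x Ux|v]; first by apply: differentiableZl; exact: da.
  apply: (@Ck_ext _ _ _ _ (fun x => 'D_v a x *: w)) => //; last by apply: IH; exact: ca.
  move=> x Ux; rewrite !deriveE ?diffZl //; first exact: da.
    by apply: differentiableZl; exact: da.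
  exact: da.
have -> : f = \sum_(j < m) (fun x => f x ord0 j *: delta_mx ord0 j).
  by apply/funext => x; rewrite fct_sumE; exact: row_sum_delta.
by apply: Ck_sum => // j; exact: key.
Qed.

Lemma Ck_comp (V : normedModType R) m k (U : set V) (U' : set 'rV[R]_m)
    (f : V -> 'rV[R]_m) (g : 'rV[R]_m -> R) :
  open U -> (forall x, U x -> U' (f x)) -> Ck k U f -> Ck k U' g -> Ck k U (g \o f).
Proof.
move=> oU fU; elim: k g => [|k IH] g.
  by move=> cf cg x Ux; apply: continuous_comp; [exact: cf|exact/cg/fU].
move=> Hf Hg; have := Hf; have := Hg; move=> [dg cg] [df cf]; split=> [x Ux|v].
  by apply: differentiable_comp; [exact: df|exact/dg/fU].
apply: (@Ck_ext _ _ _ _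
  (\sum_(j < m) ((fun x => 'D_v f x ord0 j) * ('D_(delta_mx ord0 j) g \o f)))) => //.
  move=> x Ux; have dfx := df _ Ux; have dgx := dg _ (fU _ Ux).
  rewrite (deriveE v (differentiable_comp dfx dgx)) (diff_comp dfx dgx) /=.
  rewrite -(deriveE v dfx) [X in 'd g (f x) X]row_sum_delta linear_sum fct_sumE.
  by apply: eq_bigr => j _; rewrite linearZ /= fctE /= (deriveE _ dgx).
apply: Ck_sum => // j; apply: CkM => //; first by apply: Ck_coord => //; exact: cf.
by apply: IH; [exact: CkW|exact: cg].
Qed.

Lemma Ck_comp_rV (V : normedModType R) m p k (U : set V) (U' : set 'rV[R]_m)
    (f : V -> 'rV[R]_m) (g : 'rV[R]_m -> 'rV[R]_p) :
  open U -> open U' -> (forall x, U x -> U' (f x)) -> Ck k U f -> Ck k U' g ->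
  Ck k U (g \o f).
Proof.
move=> oU oU' fU cf cg; apply: Ck_rV => // j.
apply: (@Ck_comp _ _ _ U U' f (fun y => g y ord0 j)) => //; exact: Ck_coord.
Qed.

Lemma Ck_id (V : normedModType R) k (U : set V) : Ck k U (id : V -> V).
Proof.
case: k => [|k]; first by move=> x _; exact: cvg_id.
split=> [x _|v]; first exact: ex_diff.
suff -> : 'D_v (id : V -> V) = cst v by exact: Ck_cst.
by apply/funext => x; rewrite derive_id.
Qed.

End Ck_theory.

Section smooth_maps.
Context {R : realType}.

Definition smooth_on n m (U : set 'rV[R]_n) (f : 'rV[R]_n -> 'rV[R]_m) : Prop :=
  open U /\ forall k, Ck k U f.

(* The extension [g] is arbitrary outside [U]. *)
Definition smooth_map n m (U : set 'rV[R]_n) (f : U -> 'rV[R]_m) : Prop :=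
  exists2 g : 'rV[R]_n -> 'rV[R]_m, smooth_on U g & forall r : U, g (val r) = f r.

Lemma smooth_on_open_preimage n m (U : set 'rV[R]_n) (V : set 'rV[R]_m) f :
  smooth_on U f -> open V -> open (U `&` f @^-1` V).
Proof.
move=> [oU cf] oV; rewrite openE => x [Ux Vx]; apply: filterI.
  exact: open_nbhs_nbhs.
by apply: (cf 0%N x Ux); exact: open_nbhs_nbhs.
Qed.

Lemma smooth_on_subset n m (U V : set 'rV[R]_n) (f : 'rV[R]_n -> 'rV[R]_m) :
  open V -> V `<=` U -> smooth_on U f -> smooth_on V f.
Proof. by move=> oV VU [_ cf]; split=> // k; exact: Ck_subset (cf k). Qed.

Lemma smooth_on_comp n m p (U : set 'rV[R]_n) (V : set 'rV[R]_m)
    (f : 'rV[R]_n -> 'rV[R]_m) (g : 'rV[R]_m -> 'rV[R]_p) :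
  smooth_on U f -> smooth_on V g -> (forall x, U x -> V (f x)) ->
  smooth_on U (g \o f).
Proof. by move=> [oU cf] [oV cg] fUV; split=> // k; exact: Ck_comp_rV (cg k). Qed.

End smooth_maps.

Definition sub_incl {T : Type} {V U : set T} (VU : V `<=` U) (s : V) : U :=
  exist _ (val s) (mem_set (VU _ (set_mem (valP s)))).

Section restrictions.
Context {R : realType}.

Lemma sub_incl_smooth n (V U : set 'rV[R]_n) (VU : V `<=` U) :
  open V -> smooth_map (fun s => val (sub_incl VU s)).
Proof. by move=> oV; exists id => //; split=> // k; exact: Ck_id. Qed.

Lemma open_locally n (U : set 'rV[R]_n) :
  (forall r : U, exists (V : set 'rV[R]_n) (VU : V `<=` U),
    open V /\ V (val r)) -> open U.
Proof.
move=> H; rewrite openE => x Ux.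
have [V [VU [oV Vx]]] := H (exist _ x (mem_set Ux)).
by apply: filterS VU _; exact: open_nbhs_nbhs.
Qed.

Lemma smooth_map_restr n m (V : set 'rV[R]_m) (U W : set 'rV[R]_n) (F : V -> U) :
  smooth_map (fun s => val (F s)) -> open W -> W `<=` U ->
  exists (V' : set 'rV[R]_m) (VV : V' `<=` V) (F' : V' -> W),
    [/\ smooth_map (fun s => val (F' s)),
        forall s, val (F' s) = val (F (sub_incl VV s)) &
        forall s : V, W (val (F s)) -> V' (val s)].
Proof.
move=> [g sg gF] oW WU; pose V' := V `&` g @^-1` W.
have VV : V' `<=` V by move=> x [].
have VW (s : V') : val (F (sub_incl VV s)) \in W.
  by rewrite -gF; apply: mem_set; case: (set_mem (valP s)).
exists V', VV, (fun s => exist (fun x => x \in W) _ (VW s)); split=> //.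
  exists g; last by move=> r /=; rewrite -gF.
  by apply: (smooth_on_subset _ VV sg); exact: (smooth_on_open_preimage sg oW).
move=> s; rewrite -gF; split=> //; exact/set_mem/valP.
Qed.

End restrictions.

Record diffeology (R : realType) (X : Type) := Diffeology {
  plot : forall n (U : set 'rV[R]_n), (U -> X) -> Prop;
  plot_open : forall n (U : set 'rV[R]_n) (P : U -> X), plot P -> open U;
  plot_cst : forall n (U : set 'rV[R]_n) (x : X),
    open U -> plot (fun _ : U => x);
  plot_local : forall n (U : set 'rV[R]_n) (P : U -> X),
    (forall r : U, exists (V : set 'rV[R]_n) (VU : V `<=` U),
      [/\ open V, V (val r) & plot (P \o sub_incl VU)]) -> plot P;
  plot_comp : forall n m (V : set 'rV[R]_m) (U : set 'rV[R]_n) (F : V -> U)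
      (P : U -> X),
    smooth_map (fun s => val (F s)) -> plot P -> plot (P \o F) }.

Section diffeological_notions.
Context {R : realType}.

Definition smooth {X Y : Type} (DX : diffeology R X) (DY : diffeology R Y)
    (f : X -> Y) : Prop :=
  forall n (U : set 'rV[R]_n) (P : U -> X), plot DX P -> plot DY (f \o P).

(* [P @^-1` A] is a subset of the topological space [U]. *)
Definition D_open {X : Type} (DX : diffeology R X) (A : set X) : Prop :=
  forall n (U : set 'rV[R]_n) (P : U -> X), plot DX P -> open (P @^-1` A).

Section subset_diffeology.
Context {X : Type} (DX : diffeology R X) (A : set X).

Definition subset_plot n (U : set 'rV[R]_n) (P : U -> A) : Prop :=
  plot DX (fun r => val (P r)).

Lemma subset_plot_open n (U : set 'rV[R]_n) (P : U -> A) :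
  subset_plot P -> open U.
Proof. exact: plot_open. Qed.

Lemma subset_plot_cst n (U : set 'rV[R]_n) (x : A) :
  open U -> subset_plot (fun _ : U => x).
Proof. exact: plot_cst. Qed.

Lemma subset_plot_local n (U : set 'rV[R]_n) (P : U -> A) :
  (forall r : U, exists (V : set 'rV[R]_n) (VU : V `<=` U),
    [/\ open V, V (val r) & subset_plot (P \o sub_incl VU)]) -> subset_plot P.
Proof. exact: plot_local. Qed.

Lemma subset_plot_comp n m (V : set 'rV[R]_m) (U : set 'rV[R]_n) (F : V -> U)
    (P : U -> A) :
  smooth_map (fun s => val (F s)) -> subset_plot P -> subset_plot (P \o F).
Proof. exact: plot_comp. Qed.

Definition subset_diffeology : diffeology R A :=
  Diffeology subset_plot_open subset_plot_cst subset_plot_local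
    subset_plot_comp.

End subset_diffeology.

Section union_power_set_diffeology.
Context {X : Type} (DX : diffeology R X).

Definition union_plot n (U : set 'rV[R]_n) (P : U -> set X) : Prop :=
  exists (J : Type) (Ui : J -> set 'rV[R]_n) (Pi : forall i, Ui i -> set X),
  [/\ forall i, open (Ui i),
      U = \bigcup_i Ui i,
      forall i, (forall r : Ui i, Pi i r = set0) \/
        (exists2 p : Ui i -> X, plot DX p & forall r, Pi i r = [set p r]) &
      forall r : U,
        P r = [set x | exists i (s : Ui i), val s = val r /\ Pi i s x]].

Lemma union_plotP n (U : set 'rV[R]_n) (P : U -> set X) :
  union_plot P <->
  open U /\ forall (r0 : U) (x0 : X), P r0 x0 ->
    exists (V : set 'rV[R]_n) (VU : V `<=` U) (sigma : V -> X),
      [/\ V (val r0), plot DX sigma, forall r, P (sub_incl VU r) (sigma r) &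
          forall r, val r = val r0 -> sigma r = x0].
Proof.
split=> [[J [Ui [Pi [oUi UE HPi PE]]]]|[oU HP]].
  split=> [|r0 x0]; first by rewrite UE; apply: bigcup_open => i _.
  rewrite PE => -[i [s [sr0 Pis]]].
  have UiU : Ui i `<=` U by move=> x Uix; rewrite UE; exists i.
  have [Pi0|[p pp PiE]] := HPi i; first by move: Pis; rewrite Pi0.
  exists (Ui i), UiU, p; split=> //.
  - by rewrite -sr0; exact/set_mem/valP.
  - by move=> r; rewrite PE; exists i, r; rewrite PiE.
  - move=> r rr0; move: Pis; rewrite PiE => ->; congr p.
    by apply: val_inj; rewrite rr0 sr0.
pose J0 := {V : set 'rV[R]_n & {VU : V `<=` U & {sigma : V -> X |
  plot DX sigma /\ forall r, P (sub_incl VU r) (sigma r)}}}.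
pose Ui (i : option J0) := if i is Some j then projT1 j else U.
pose Pi (i : option J0) : Ui i -> set X :=
  match i return Ui i -> set X with
  | Some j => fun r => [set sval (projT2 (projT2 j)) r]
  | None => fun _ => set0
  end.
exists (option J0), Ui, Pi; split.
- by case=> [[V [VU [sigma [ps ?]]]]|] //=; exact: plot_open ps.
- apply/seteqP; split=> [x Ux|x [[[V [VU ?]]|] _ //= Vx]]; first by exists None.
  by apply: (VU _ Vx).
- case=> [[V [VU [sigma [ps ?]]]]|] /=; last by left.
  by right; exists sigma.
- move=> r; apply/seteqP; split=> [x /HP[V [VU [sigma [Vr ps Ps sx]]]]|x].
    pose j : J0 := existT _ V (existT _ VU (exist _ sigma (conj ps Ps))).
    exists (Some j), (exist _ (val r) (mem_set Vr) : V); split=> //=.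
    by rewrite sx.
  move=> [[[V [VU [sigma [ps Ps]]]]|] [s [sr //= xs]]].
  have -> : r = sub_incl VU s by apply: val_inj; rewrite /= sr.
  by rewrite xs.
Qed.

Lemma union_plot_open n (U : set 'rV[R]_n) (P : U -> set X) :
  union_plot P -> open U.
Proof. by move=> /union_plotP[]. Qed.

Lemma union_plot_cst n (U : set 'rV[R]_n) (A : set X) :
  open U -> union_plot (fun _ : U => A).
Proof.
move=> oU; apply/union_plotP; split=> // r0 x0 Ax0.
exists U, (@subset_refl _ U), (fun=> x0); split=> //.
  exact/set_mem/valP.
exact: plot_cst.
Qed.

Lemma union_plot_local n (U : set 'rV[R]_n) (P : U -> set X) :
  (forall r : U, exists (V : set 'rV[R]_n) (VU : V `<=` U),
    [/\ open V, V (val r) & union_plot (P \o sub_incl VU)]) -> union_plot P.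
Proof.
move=> H; apply/union_plotP; split.
  by apply: open_locally => r; have [V [VU [? ? _]]] := H r; exists V, VU.
move=> r0 x0 Px0; have [V [VU [oV Vr0 /union_plotP[_ HV]]]] := H r0.
have [|W [WV [sigma [Wr0 ps Ps sx]]]] := HV (exist _ (val r0) (mem_set Vr0)) x0.
  rewrite /= (_ : sub_incl _ _ = r0) //; exact: val_inj.
exists W, (subset_trans WV VU), sigma; split=> // r.
rewrite (_ : sub_incl _ r = sub_incl VU (sub_incl WV r)); first exact: Ps.
exact: val_inj.
Qed.

Lemma union_plot_comp n m (V : set 'rV[R]_m) (U : set 'rV[R]_n) (F : V -> U)
    (P : U -> set X) :
  smooth_map (fun s => val (F s)) -> union_plot P -> union_plot (P \o F).
Proof.
move=> sF /union_plotP[oU HP]; apply/union_plotP.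
split=> [|r0 x0 Px0]; first by case: sF => g [].
have [W [WU [sigma [Wr0 ps Ps sx]]]] := HP _ _ Px0.
have [V' [VV [F' [sF' F'E VW]]]] := smooth_map_restr sF (plot_open ps) WU.
exists V', VV, (sigma \o F'); split.
- exact: VW.
- exact: plot_comp.
- move=> r /=; rewrite (_ : F _ = sub_incl WU (F' r)); first exact: Ps.
  by apply: val_inj; rewrite /= F'E.
- move=> r rr0 /=; apply: sx; rewrite F'E; congr (val (F _)).
  exact: val_inj.
Qed.

Definition union_power_set_diffeology : diffeology R (set X) :=
  Diffeology union_plot_open union_plot_cst union_plot_local union_plot_comp.

Definition nonempty_power_set : set (set X) := [set A | A !=set0].

Definition nonempty_union_power_set_diffeology :
    diffeology R nonempty_power_set :=
  subset_diffeology union_power_set_diffeology nonempty_power_set.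

End union_power_set_diffeology.

End diffeological_notions.

Arguments nonempty_power_set X : clear implicits.

(* A homeomorphism from an open subset of [M] onto an open subset of R^d. *)
Record chart (R : realType) (d : nat) (M : topologicalType) := Chart {
  chart_dom : set M;
  chart_cod : set 'rV[R]_d;
  chart_map : chart_dom -> chart_cod;
  chart_inv : chart_cod -> chart_dom;
  chart_dom_open : open chart_dom;
  chart_cod_open : open chart_cod;
  chart_mapK : cancel chart_map chart_inv;
  chart_invK : cancel chart_inv chart_map;
  chart_map_continuous : continuous chart_map;
  chart_inv_continuous : continuous chart_inv }.

Definition chart_overlap (R : realType) d (M : topologicalType)
    (c c' : chart R d M) : set 'rV[R]_d :=
  [set val (chart_map x) | x in [set x : chart_dom c | chart_dom c' (val x)]].

(* The transition map c' o c^-1 is smooth on c(dom c `&` dom c'). *)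
Definition transition_smooth (R : realType) d (M : topologicalType)
    (c c' : chart R d M) : Prop :=
  exists2 g : 'rV[R]_d -> 'rV[R]_d, smooth_on (chart_overlap c c') g &
    forall (x : chart_dom c) (x' : chart_dom c'), val x = val x' ->
      g (val (chart_map x)) = val (chart_map x').

(* Any atlas is allowed: a maximal one has the same plots. *)
Record manifold (R : realType) (d : nat) := Manifold {
  manifold_space :> topologicalType;
  atlas : set (chart R d manifold_space);
  manifold_hausdorff : hausdorff_space manifold_space;
  manifold_second_countable : @second_countable manifold_space;
  atlas_cover : forall x : manifold_space, exists2 c, atlas c & chart_dom c x;
  atlas_compatible : forall c c', atlas c -> atlas c' -> transition_smooth c c' }.

Section manifold_diffeology.
Context {R : realType} {d : nat} (M : manifold R d).

(* [P] is locally the inclusion of a map [Q] into a chart domain, with smooth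
   coordinate expression. *)
Definition manifold_plot n (U : set 'rV[R]_n) (P : U -> M) : Prop :=
  open U /\ forall r : U,
    exists (c : chart R d M) (V : set 'rV[R]_n) (VU : V `<=` U)
      (Q : V -> chart_dom c),
    [/\ atlas c, V (val r), forall s, val (Q s) = P (sub_incl VU s) &
        smooth_map (fun s => val (chart_map (Q s)))].

Lemma manifold_plot_open n (U : set 'rV[R]_n) (P : U -> M) :
  manifold_plot P -> open U.
Proof. by case. Qed.

Lemma manifold_plot_cst n (U : set 'rV[R]_n) (x : M) :
  open U -> manifold_plot (fun _ : U => x).
Proof.
move=> oU; split=> // r; have [c ac cx] := atlas_cover x.
pose x' : chart_dom c := exist _ x (mem_set cx).
exists c, U, (@subset_refl _ U), (fun=> x'); split=> //.
  exact/set_mem/valP.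
exists (cst (val (chart_map x'))) => //.
by split=> // k; exact: Ck_cst.
Qed.

Lemma manifold_plot_local n (U : set 'rV[R]_n) (P : U -> M) :
  (forall r : U, exists (V : set 'rV[R]_n) (VU : V `<=` U),
    [/\ open V, V (val r) & manifold_plot (P \o sub_incl VU)]) ->
  manifold_plot P.
Proof.
move=> H; split.
  by apply: open_locally => r; have [V [VU [? ? _]]] := H r; exists V, VU.
move=> r; have [V [VU [oV Vr [_ HV]]]] := H r.
have [c [W [WV [Q [ac Wr QE sQ]]]]] := HV (exist _ (val r) (mem_set Vr)).
exists c, W, (subset_trans WV VU), Q; split=> // s.
by rewrite QE /=; congr P; exact: val_inj.
Qed.

Lemma manifold_plot_comp n m (V : set 'rV[R]_m) (U : set 'rV[R]_n) (F : V -> U)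
    (P : U -> M) :
  smooth_map (fun s => val (F s)) -> manifold_plot P -> manifold_plot (P \o F).
Proof.
move=> sF [oU HP]; split=> [|r]; first by case: sF => g [].
have [c [W [WU [Q [ac Wr QE [g [oW sg] gQ]]]]]] := HP (F r).
have [V' [VV [F' [[f sf fF'] F'E VW]]]] := smooth_map_restr sF oW WU.
exists c, V', VV, (Q \o F'); split=> //.
- exact: VW.
- by move=> s; rewrite /= QE; congr P; apply: val_inj; rewrite /= F'E.
- exists (g \o f); last by move=> s; rewrite /= fF' gQ.
  apply: (smooth_on_comp sf (conj oW sg)) => x V'x.
  have := fF' (exist _ x (mem_set V'x)) => /= ->.
  exact/set_mem/valP.
Qed.

Definition manifold_diffeology : diffeology R M :=
  Diffeology manifold_plot_open manifold_plot_cst manifold_plot_local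
    manifold_plot_comp.

Lemma chart_inv_plot (c : chart R d M) :
  atlas c -> manifold_plot (fun v : chart_cod c => val (chart_inv v)).
Proof.
move=> ac; split=> [|v]; first exact: chart_cod_open.
exists c, (chart_cod c), (@subset_refl _ (chart_cod c)), (@chart_inv _ _ _ c).
split=> //; first exact/set_mem/valP.
  by move=> s; congr (val (chart_inv _)); exact: val_inj.
exists id; last by move=> s; rewrite chart_invK.
by split=> [|k]; [exact: chart_cod_open|exact: Ck_id].
Qed.

Lemma open_val_image (T : topologicalType) (U : set T) (S : set U) :
  open U -> open S -> open (val @` S).
Proof.
move=> oU [W oW <-]; rewrite (_ : _ @` _ = U `&` W); first exact: openI.
apply/seteqP; split=> [_ [x Wx <-]|x [Ux Wx]].
  by split=> //; exact/set_mem/valP.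
by exists (exist _ x (mem_set Ux)).
Qed.

Lemma open_val_preimage (T : topologicalType) (U : set T) (W : set T) :
  open W -> open (val @^-1` W : set U).
Proof. by move=> oW; exists W. Qed.

Lemma D_open_manifoldP (A : set M) : D_open manifold_diffeology A <-> open A.
Proof.
split=> [oA|oA n U P [oU HP]].
  rewrite openE => p Ap; have [c ac cp] := atlas_cover p.
  pose B : set (chart_cod c) := [set v | A (val (chart_inv v))].
  have oB : open B by exact: (oA _ _ _ (chart_inv_plot ac)).
  pose C : set (chart_dom c) := @chart_map _ _ _ c @^-1` B.
  have oC : open C.
    by apply: open_comp => // x _; exact: chart_map_continuous.
  have oC' := open_val_image (@chart_dom_open _ _ _ c) oC.
  have CA : val @` C `<=` A by move=> _ [x + <-]; rewrite /C /B /= chart_mapK.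
  apply: filterS CA _; apply: open_nbhs_nbhs; split=> //.
  by exists (exist _ p (mem_set cp)) => //; rewrite /C /B /= chart_mapK.
rewrite openE => r Ar.
have [c [V [VU [Q [ac Vr QE [g sg gQ]]]]]] := HP r.
pose B : set (chart_cod c) := [set v | A (val (chart_inv v))].
have oB : open B.
  apply: (@open_comp _ _ (@chart_inv _ _ _ c) [set x | A (val x)]).
    by move=> x _; exact: chart_inv_continuous.
  exact: open_val_preimage.
have oB' := open_val_image (@chart_cod_open _ _ _ c) oB.
pose W := V `&` g @^-1` (val @` B).
have oW : open W by exact: smooth_on_open_preimage sg oB'.
have WA : val @^-1` W `<=` P @^-1` A.
  move=> s [Vs [v Bv vg]] /=; pose s' : V := exist _ (val s) (mem_set Vs).
  have -> : P s = val (Q s') by rewrite QE; congr P; exact: val_inj.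
  have E : v = chart_map (Q s') by apply: val_inj; rewrite vg -gQ.
  by move: Bv; rewrite /B /= E chart_mapK.
apply: filterS WA _; apply: open_nbhs_nbhs; split; first exact: open_val_preimage.
split=> //; pose r' : V := exist _ (val r) (mem_set Vr).
exists (chart_map (Q r')); last by rewrite -gQ.
rewrite /B /= chart_mapK QE (_ : sub_incl VU r' = r) //; exact: val_inj.
Qed.

End manifold_diffeology.

(* Main.v *)
Require Import Defs.
From mathcomp Require Import all_boot all_order all_algebra.
From mathcomp Require Import all_classical all_reals all_analysis.
Import numFieldNormedType.Exports.
Local Open Scope classical_set_scope.

(** Forwards, apply the local-section characterization of union plots to [phi]
    read in a chart at [p0], and compose the resulting section with the chart
    map.  Backwards, compose [alpha] with the restriction of a plot to the
    preimage of [O]. *)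

(** A manifold plot is known to be smooth only in some atlas chart near each point; composing with
    the transition map makes it smooth in the prescribed chart [c]. *)
Lemma smooth_map_chart {R : realType} {d : nat} {M : manifold R d}
    {c : chart R d M} {n : nat} {U : set 'rV[R]_n} (P : U -> chart_dom c) :
  atlas c -> manifold_plot (fun r => val (P r)) ->
  forall r : U, exists (V : set 'rV[R]_n) (VU : V `<=` U),
    [/\ open V, V (val r) &
        smooth_map (fun s => val (chart_map (P (sub_incl VU s))))].
Proof.
move=> ac [_ HP] r.
have [c' [V [VU [Q [ac' Vr QE [g sg gQ]]]]]] := HP r.
have [t st tE] := atlas_compatible ac' ac.
exists V, VU; split=> //; first by case: sg.
exists (t \o g); last by move=> s /=; rewrite gQ; exact: tE.
(* On [V] the expression [g] lands in the overlap of the charts, since [Q s] is a value of [P] and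
   so lies in the domain of [c] as well. *)
apply: (smooth_on_comp sg st) => x Vx; pose s : V := exist _ x (mem_set Vx).
exists (Q s); last by rewrite -gQ.
by rewrite /= QE; exact/set_mem/valP.
Qed.

Lemma chart_open_preimage (R : realType) (d : nat) (M : manifold R d)
    (c : chart R d M) (V : set 'rV[R]_d) :
  open V -> open (val @` [set x : chart_dom c | V (val (chart_map x))]).
Proof.
move=> oV; apply: open_val_image; first exact: chart_dom_open.
apply: (@open_comp _ _ (@chart_map _ _ _ c) (val @^-1` V)).
  by move=> x _; exact: chart_map_continuous.
exact: open_val_preimage.
Qed.

(** Here [beta] is the chart map with values restricted to [V]. Along a plot of [O] it is locally a
    smooth map into [V], which the plot [sigma] may be composed with; locality of [DX] glues the
    pieces. *)
Lemma chart_pullback_smooth {R : realType} {d : nat} {M : manifold R d}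
    {c : chart R d M} {X : Type} {DX : diffeology R X} {V : set 'rV[R]_d}
    {sigma : V -> X} {O : set M} (beta : O -> V) (OD : O `<=` chart_dom c) :
  atlas c -> plot DX sigma ->
  (forall p, val (beta p) = val (chart_map (sub_incl OD p))) ->
  smooth (subset_diffeology (manifold_diffeology M) O) DX (sigma \o beta).
Proof.
move=> ac ps betaE n U P pP; apply: plot_local => r.
have [W [WU [oW Wr [g sg gE]]]] :=
  smooth_map_chart (sub_incl OD \o P) ac pP r.
exists W, WU; split=> //.
apply: (plot_comp (F := beta \o P \o sub_incl WU)) ps.
by exists g => // s; rewrite gE /= betaE.
Qed.

Theorem proposition3p22 (R : realType) (d : nat) (M : manifold R d) (X : Type)
    (DX : diffeology R X) (phi : M -> nonempty_power_set X) :
  smooth (manifold_diffeology M) (nonempty_union_power_set_diffeology DX) phi <->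
  forall (p0 : M) (x0 : X), val (phi p0) x0 ->
    exists (O : set M) (p0O : p0 \in O) (alpha : O -> X),
      [/\ D_open (manifold_diffeology M) O,
          smooth (subset_diffeology (manifold_diffeology M) O) DX alpha,
          alpha (exist _ p0 p0O) = x0 &
          forall p : O, val (phi (val p)) (alpha p)].
Proof.
split=> [sphi p0 x0 px0|H n U P pP].
  have [c ac cp0] := atlas_cover p0.
  pose p0' : chart_dom c := exist _ p0 (mem_set cp0).
  (* The inverse chart is a plot of [M], so [phi] read in coordinates is a union plot. *)
  have /union_plotP[_ Hs] := sphi _ _ _ (chart_inv_plot ac).
  have [|V [VU [sigma [Vp0 ps Ps sx]]]] := Hs (chart_map p0') x0.
    by rewrite /= chart_mapK.
  (* The points whose coordinates lie in the domain of [sigma]. *)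
  pose O := val @` [set x : chart_dom c | V (val (chart_map x))].
  have OD : O `<=` chart_dom c by move=> _ [x _ <-]; exact/set_mem/valP.
  have OV (p : O) : val (chart_map (sub_incl OD p)) \in V.
    apply: mem_set; have [x Vx xp] := set_mem (valP p).
    by rewrite (_ : sub_incl OD p = x) //; exact: val_inj.
  pose beta (p : O) : V := exist (fun v => v \in V) _ (OV p).
  have p0O : p0 \in O by apply: mem_set; exists p0'.
  exists O, p0O, (sigma \o beta); split.
  - by apply/D_open_manifoldP/chart_open_preimage; exact: plot_open ps.
  - exact: (chart_pullback_smooth beta OD).
  - by apply: sx => /=; congr (val (chart_map _)); exact: val_inj.
  - move=> p /=; have := Ps (beta p) => /=.
    rewrite (_ : sub_incl VU (beta p) = chart_map (sub_incl OD p)).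
      by rewrite chart_mapK.
    exact: val_inj.
apply/union_plotP; split=> [|r0 x0 Px0]; first exact: plot_open pP.
have [W [p0W [alpha [oW salpha ax Wa]]]] := H _ _ Px0.
(* D-openness of [W] makes this preimage open in [U], hence in the Euclidean space. *)
pose V := val @` (P @^-1` W).
have oV : open V by apply: open_val_image; [exact: plot_open pP|exact: oW pP].
have VU : V `<=` U by move=> _ [s _ <-]; exact/set_mem/valP.
have VW (s : V) : P (sub_incl VU s) \in W.
  apply: mem_set; have [t Wt ts] := set_mem (valP s).
  by rewrite (_ : sub_incl VU s = t) //; exact: val_inj.
pose Q (s : V) : W := exist (fun p => p \in W) _ (VW s).
exists V, VU, (alpha \o Q); split.
- by exists r0 => //; exact: set_mem p0W.
- apply: salpha; exact: (plot_comp (sub_incl_smooth VU oV) pP).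
- by move=> s; exact: (Wa (Q s)).
(* Points of [W] are equal once their underlying points of [M] are, whatever the membership
   proofs. *)
- move=> s sr0; rewrite -ax /=; congr alpha; apply: val_inj => /=.
  by congr P; exact: val_inj.
Qed.
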